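(* Let $(W,S)$ be a finite Coxeter system. For every subset $J\subseteq S$ and every integer $k\geq 1$, the number of $k$-chains $u_1\leq_\sigma u_2\leq_\sigma\dots\leq_\sigma u_k$ in the shard order on $W$ with $S(u_k)=J$ equals the number of $k$-chains $u_1\leq_\beta u_2\leq_\beta\dots\leq_\beta u_k$ in the BHZ order on $W$ with $S(u_k)=J$.
   Context: $(W,S)$ is a finite Coxeter system with length function $\ell$. The right descent set of $w\in W$ is $D_R(w)=\{s\in S\mid \ell(ws)<\ell(w)\}$; the support $S(w)$ is the set of $s\in S$ appearing in some (equivalently any) reduced word for $w$. For $I\subseteq S$, $W_I$ is the standard parabolic subgroup generated by $I$, $W^I=\{w\in W\mid D_R(w)\cap I=\emptyset\}$, and every $w\in W$ factors uniquely as $w=w^Iw_I$ with $w^I\in W^I$, $w_I\in W_I$ (and $\ell(w)=\ell(w^I)+\ell(w_I)$). Let $\Phi$ be a root system for $(W,S)$ with positive roots $\Phi^+$; $N(w)=\Phi^+\cap w(-\Phi^+)$ and $G(w)$ is the subgroup of $W$ generated by $\{wsw^{-1}\mid s\in D_R(w)\}$. The shard order is: $u\leq_\sigma v$ iff $N(u)\subseteq N(v)$ and $G(u)\subseteq G(v)$. The BHZ order is: $u\leq_\beta v$ iff $v_{S(u)}=u$. A $k$-chain in a poset is a weakly increasing sequence of $k$ elements $u_1\leq u_2\leq\dots\leq u_k$. *)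

(* Defs.v *)
From mathcomp Require Import all_boot all_order all_algebra all_fingroup.
From mathcomp Require Import mxrepresentation finmap boolp reals.

Set Implicit Arguments.
Unset Strict Implicit.
Unset Printing Implicit Defensive.

Import GRing.Theory Num.Theory GroupScope.

(* Bourbaki's definition: the elements of S generate W and have order 2, and
   the relations (s t)^m(s,t) = 1, with m(s,t) = #[s * t], present W.
   The presentation is stated as a universal property with respect to all
   groups, finite or not (presentation.v only tests finite groups). *)
Record coxeterSystem (W : finGroupType) := CoxeterSystem {
  gens :> {set W};
  gens_gen : <<gens>> = [set: W];
  gens_order : forall s, s \in gens -> #[s] = 2;
  gens_pres : forall (H : groupType) (f : W -> H),
    (forall s t, s \in gens -> t \in gens -> (f s * f t) ^+ #[s * t] = 1) ->
    exists2 g : W -> H, {morph g : x y / x * y} & {in gens, g =1 f}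
}.

Section Coxeter.

Variables (W : finGroupType) (C : coxeterSystem W).
Implicit Types (w u v : W) (I : {set W}).

Definition is_word k w (t : k.-tuple W) : bool :=
  all [in gens C] t && (\prod_(s <- t) s == w).

Definition has_word w k : bool := [exists t : k.-tuple W, is_word w t].

Fact has_word_ex w : exists k, has_word w k.
Proof.
have : w \in <<gens C>> by rewrite gens_gen inE.
case/gen_prodgP=> k [c cS ->]; exists k; apply/existsP; exists [tuple c i | i < k].
rewrite /is_word big_tuple; apply/andP; split.
  by apply/all_tnthP=> i; rewrite tnth_mktuple; apply: cS.
by apply/eqP/eq_bigr=> i _; rewrite tnth_mktuple.
Qed.

Definition ell w : nat := ex_minn (has_word_ex w).

Definition descR w : {set W} := [set s in gens C | ell (w * s) < ell w].

Definition supp w : {set W} :=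
  [set s | [exists t : (ell w).-tuple W, is_word w t && (s \in t)]].

(* W^I *)
Definition min_reps I : {set W} := [set w | [disjoint descR w & I]].

(* w_I: the element of W_I = <<I>> with w * (w_I)^-1 = w^I in W^I. For I a
   subset of gens C it exists and is unique, so the default 1 is never used. *)
Definition parab_part w I : W :=
  odflt 1 [pick y in <<I>> | w * y^-1 \in min_reps I].

Definition bhz_le u v : bool := parab_part v (supp u) == u.

(* x ^ w^-1 is w * x * w^-1 in MathComp. *)
Definition shardG w : {group W} := <<[set s ^ w^-1 | s in descR w]>>%G.

(* The k-chains u_1 <= ... <= u_k with S(u_k) = J, for k >= 1; the default
   value 1 of last only matters when k = 0. *)
Definition chains (le : rel W) k (J : {set W}) : {set k.-tuple W} :=
  [set t : k.-tuple W | sorted le t & supp (last 1 t) == J].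

End Coxeter.

Section Roots.

Local Open Scope ring_scope.

Variables (R : realType) (n : nat).
Implicit Types (a b v : 'cV[R]_n).

Definition dotv a b : R := \sum_i a i 0 * b i 0.

Definition reflection a v : 'cV[R]_n := v - (2 * dotv v a / dotv a a) *: a.

Variables (W : finGroupType) (C : coxeterSystem W).

Definition nonneg_comb (alpha : W -> 'cV[R]_n) v : Prop :=
  exists2 c : W -> R,
    forall s, s \in gens C -> 0 <= c s & v = \sum_(s in gens C) c s *: alpha s.

(* A root system for (W, S) in the Euclidean space R^n: a finite reduced root
   system with simple roots alpha_s, s in S, and a faithful linear action of W
   in which every s in S acts as the orthogonal reflection in alpha_s. Roots
   may have different lengths, need not span R^n, and need not be
   crystallographic. W acts on the left on column vectors, by v |-> w *m v. *)
Record rootSystem := RootSystem {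
  rs_act : mx_representation R [set: W] n;
  rs_roots : {fset 'cV[R]_n};
  rs_simple : W -> 'cV[R]_n;
  rs_neq0 : 0 \notin rs_roots;
  rs_reduced : forall a c,
    a \in rs_roots -> c *: a \in rs_roots -> c = 1 \/ c = -1;
  rs_reflection : forall a b,
    a \in rs_roots -> b \in rs_roots -> reflection a b \in rs_roots;
  rs_simple_root : forall s, s \in gens C -> rs_simple s \in rs_roots;
  rs_simple_free : forall c : W -> R,
    \sum_(s in gens C) c s *: rs_simple s = 0 ->
    forall s, s \in gens C -> c s = 0;
  rs_simple_sign : forall a, a \in rs_roots ->
    nonneg_comb rs_simple a \/ nonneg_comb rs_simple (- a);
  rs_act_gens : forall s v, s \in gens C ->
    rs_act s *m v = reflection (rs_simple s) v;
  rs_faithful : mx_faithful rs_act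
}.

Variable Phi : rootSystem.
Implicit Types u w : W.

Local Open Scope fset_scope.

Definition pos_roots : {fset 'cV[R]_n} :=
  [fset a in rs_roots Phi | `[< nonneg_comb (rs_simple Phi) a >]].

Definition inversions w : {fset 'cV[R]_n} :=
  pos_roots `&` [fset rs_act Phi w *m (- a) | a in pos_roots].

Definition shard_le u w : bool :=
  (inversions u `<=` inversions w) && (shardG C u \subset shardG C w).

End Roots.

(* Main.v *)
(* For both orders, let f_k(J) be the number of (k+1)-chains with top in the
   parabolic subgroup W_J. Both functions satisfy f_0(J) = |W_J| and
     f_{k+1}(J) = sum over w in W_J of f_k(D_R(w)),
   so they agree, and removing the chains whose top has smaller support gives
   the theorem.

   BHZ order: u <= w iff w = x u with D_R(x) disjoint from S(u). Summing over x
   instead of w gives the recursion with J \ D_R(x) in place of D_R(x), and left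
   multiplication by the longest element of W_J exchanges the two.

   Shard order: the interval [1, w] is isomorphic to W_D, with D = D_R(w). Write
   w = x h with h in W_D and x minimal in x W_D; then u <= w corresponds to the
   y in W_D such that u = x y c^-1 with c minimal in c W_D. The key point is
   desc_lift_descent: when lengths add in u c and c maps simple roots onto those
   of D_R(u), every descent of u c that is not a descent of c arises in this way.
   It gives G(u) = x G(y) x^-1 and reduces everything to combinatorics of positive
   and negative roots. *)

Require Import Defs.
From mathcomp Require Import all_boot all_order all_algebra all_fingroup.
From mathcomp Require Import mxrepresentation finmap boolp reals.
From mathcomp Require Import ring.

Set Implicit Arguments.
Unset Strict Implicit.
Unset Printing Implicit Defensive.

Import Order.TTheory GRing.Theory Num.Theory GroupScope.

(** * Counting chains *)

Section ChainCount.

Variables (T : finType) (le : rel T).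

(* The number of chains u_1 <= ... <= u_k <= v. *)
Fixpoint nchain k (v : T) : nat :=
  if k is k'.+1 then \sum_(u | le u v) nchain k' u else 1%N.

(** Splitting off the top [v] leaves a shorter chain whose last element satisfies [le^~ v], so the
    induction runs over all [P]. The tuples are nonempty, hence [last] never returns [x0]. *)
Lemma card_chains k (P : pred T) x0 :
  #|[set t : k.+1.-tuple T | sorted le t & P (last x0 t)]|
    = \sum_(v | P v) nchain k v.
Proof.
elim: k P => [|k IH] P.
  rewrite sum1_card -[RHS](card_imset (fun x => P x) (f := fun x => [tuple x])).
    apply: eq_card => t; rewrite !inE; case: (tupleP t) => x t'; rewrite tuple0 /=.
    by apply/idP/imsetP => [Px|[y Py [->]] //]; exists x.
  by move=> x y [].
pose f (p : k.+1.-tuple T * T) : k.+2.-tuple T := [tuple of rcons p.1 p.2].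
have fbij : bijective f.
  apply: inj_card_bij => [[t x] [t' x'] /(congr1 val) /= /rcons_inj[E ->]|].
    by congr (_, _); apply: val_inj.
  by rewrite card_prod !card_tuple -expnSr.
rewrite -sum1_card (reindex f) /=; last exact: onW_bij.
pose Q t v := P v && (sorted le t && le (last x0 t) v).
rewrite (eq_bigl (fun p : k.+1.-tuple T * T => Q p.1 p.2)); last first.
  case=> t v; rewrite inE /= last_rcons; case: (tupleP t) => x t' /=.
  by rewrite rcons_path andbC.
rewrite big_mkcond -(pair_bigA _ (fun (t : k.+1.-tuple T) v => if Q t v then 1%N else 0%N)) /=.
rewrite exchange_big [RHS]big_mkcond; apply: eq_bigr => v _; rewrite /Q.
case: (P v) => /=; last by rewrite big1.
by rewrite -(IH (le^~ v)) -big_mkcond sum1_card; apply: eq_card => t; rewrite !inE.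
Qed.

(** [P] and [Q] are down-closed and [f] restricts to an order isomorphism between them. *)
Lemma nchain_iso k (f : T -> T) (P Q : pred T) v :
  (forall x y, le x y -> P y -> P x) -> (forall x y, le x y -> Q y -> Q x) ->
  (forall x, P x -> Q (f x)) -> {in P &, injective f} ->
  (forall y, Q y -> exists2 x, P x & f x = y) ->
  {in P &, {mono f : x y / le x y}} ->
  P v -> nchain k v = nchain k (f v).
Proof.
move=> dP dQ PQ fI fS fM; elim: k v => //= k IH v Pv.
transitivity (\sum_(u in [set u | le u v]) nchain k (f u)).
  rewrite big_set; apply: eq_bigr => u uv; exact/IH/(dP u v).
rewrite -(big_imset (nchain k)) => [|x y]; last first.
  by rewrite !inE => xv yv; apply: fI; apply: dP Pv.
apply: eq_bigl => y; apply/imsetP/idP => [[x]|yv].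
  by rewrite inE => xv ->; rewrite fM //; apply: dP Pv.
have [x Px E] := fS y (dQ _ _ yv (PQ v Pv)).
by exists x => //; rewrite inE -fM // E.
Qed.

End ChainCount.
(** * Roots and reflections *)

Section RootSystemTheory.

Local Open Scope ring_scope.

Variables (W : finGroupType) (C : coxeterSystem W).
Variables (R : realType) (n : nat) (Phi : rootSystem R n C).
Implicit Types (u w x y z c s : W) (v b : 'cV[R]_n) (I J D M : {set W}).

Notation S := (gens C).
Notation a := (rs_simple Phi).
Notation root v := (v \in rs_roots Phi).

Definition act w v : 'cV[R]_n := rs_act Phi w *m v.
Notation "w ** v" := (act w v) (at level 38, right associativity).

Lemma actM u w v : (u * w)%g ** v = u ** w ** v.
Proof. by rewrite /act repr_mxM ?inE // mulmxA. Qed.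

Lemma act1 v : (1%g : W) ** v = v.
Proof. by rewrite /act repr_mx1 mul1mx. Qed.

Lemma actK w v : w^-1%g ** w ** v = v.
Proof. by rewrite -actM mulVg act1. Qed.

Lemma actVK w v : w ** w^-1%g ** v = v.
Proof. by rewrite -actM mulgV act1. Qed.

Lemma actN w v : w ** (- v) = - (w ** v).
Proof. by rewrite /act mulmxN. Qed.

Lemma act_inj w : injective (act w).
Proof. by move=> v v' E; rewrite -(actK w v) E actK. Qed.

Lemma act_sum w (F : W -> R) (G : W -> 'cV[R]_n) (Q : pred W) :
  w ** (\sum_(s | Q s) F s *: G s) = \sum_(s | Q s) F s *: (w ** G s).
Proof. by rewrite /act mulmx_sumr; apply: eq_bigr => s _; rewrite -scalemxAr. Qed.

Lemma act_simple s v : s \in S -> s ** v = reflection (a s) v.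
Proof. exact: rs_act_gens. Qed.

Lemma gen_ind (Q : W -> Prop) I : Q 1%g ->
  (forall s w, s \in I -> Q w -> Q (s * w)%g) ->
  forall w, w \in <<I>> -> Q w.
Proof.
move=> Q1 QM w /gen_prodgP[k [c cI ->]].
elim: k c cI => [|k IH] c cI; first by rewrite big_ord0.
by rewrite big_ord_recl; apply: QM => //; apply: IH.
Qed.

Lemma in_gen_gens w : w \in <<S>>.
Proof. by rewrite gens_gen inE. Qed.

Lemma gens_invol s : s \in S -> (s * s = 1)%g.
Proof. by move=> /(gens_order (c:=C)) o2; rewrite -(expg_order s) o2. Qed.

Lemma gens_inv s : s \in S -> (s^-1 = s)%g.
Proof. by move=> /gens_invol E; apply: (mulgI s); rewrite mulgV. Qed.

Lemma dotvDl v1 v2 v : dotv (v1 + v2) v = dotv v1 v + dotv v2 v.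
Proof. by rewrite /dotv -big_split; apply: eq_bigr => i _; rewrite !mxE mulrDl. Qed.

Lemma dotvC v1 v2 : dotv v1 v2 = dotv v2 v1.
Proof. by apply: eq_bigr => i _; rewrite mulrC. Qed.

Lemma dotvZl k v1 v : dotv (k *: v1) v = k * dotv v1 v.
Proof. by rewrite /dotv mulr_sumr; apply: eq_bigr => i _; rewrite !mxE mulrA. Qed.

Lemma dotv_eq0 v : (dotv v v == 0) = (v == 0).
Proof.
apply/eqP/eqP=> [|->]; last by apply: big1 => i _; rewrite mxE mul0r.
move=> /eqP; rewrite psumr_eq0 => [/allP E|i _]; last by rewrite -expr2 sqr_ge0.
apply/matrixP => i j; rewrite ord1 mxE.
by have := E i (mem_index_enum i); rewrite mulf_eq0 orbb => /eqP.
Qed.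

Lemma dotvDr v v1 v2 : dotv v (v1 + v2) = dotv v v1 + dotv v v2.
Proof. by rewrite ![dotv v _]dotvC dotvDl. Qed.

Lemma dotvZr k v v1 : dotv v (k *: v1) = k * dotv v v1.
Proof. by rewrite ![dotv v _]dotvC dotvZl. Qed.

Lemma reflection_dotv b v v' : b != 0 ->
  dotv (reflection b v) (reflection b v') = dotv v v'.
Proof.
rewrite -dotv_eq0 /reflection -!scaleNr => b0.
rewrite !(dotvDl, dotvZl, dotvDr, dotvZr) [dotv b v']dotvC.
by field.
Qed.

Lemma reflection_self b : b != 0 -> reflection b b = - b.
Proof.
rewrite -dotv_eq0 /reflection => b0.
by rewrite mulfK // scaler_nat mulr2n opprD addNKr.
Qed.

Lemma root_neq0 v : root v -> v != 0.
Proof. by apply: contraTneq => ->; exact: (rs_neq0 Phi). Qed.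

Lemma simple_neq0 s : s \in S -> a s != 0.
Proof. by move=> /(rs_simple_root Phi); exact: root_neq0. Qed.

Lemma act_dotv w v v' : dotv (w ** v) (w ** v') = dotv v v'.
Proof.
move: w (in_gen_gens w) v v'; apply: gen_ind => [|s w sS IH] v v'; first by rewrite !act1.
by rewrite !actM !(act_simple _ sS) reflection_dotv ?simple_neq0.
Qed.

Lemma act_root w v : root v -> root (w ** v).
Proof.
move=> rv; move: w (in_gen_gens w); apply: gen_ind => [|s w sS IH]; first by rewrite act1.
by rewrite actM (act_simple _ sS) rs_reflection ?rs_simple_root ?IH.
Qed.

Lemma rootN v : root v -> root (- v).
Proof.
by move=> rv; rewrite -reflection_self ?root_neq0 // rs_reflection.
Qed.

Lemma act_reflection w b v : reflection (w ** b) (w ** v) = w ** reflection b v.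
Proof. by rewrite /reflection !act_dotv /act mulmxBr scalemxAr. Qed.

Lemma act_simple_self s : s \in S -> s ** a s = - a s.
Proof. by move=> sS; rewrite (act_simple _ sS) reflection_self ?simple_neq0. Qed.

Lemma faithful w w' : (forall v, w ** v = w' ** v) -> w = w'.
Proof.
move=> E; apply: (mx_faithful_inj (rs_faithful Phi)); rewrite ?inE //.
apply/matrixP=> i j.
have := E (delta_mx j 0); rewrite /act => /matrixP/(_ i 0).
by rewrite -!colE !mxE.
Qed.

(** Conjugating the reflection in [a s] by [g] gives the reflection in [g ** a s], and the action is
    faithful. *)
Lemma conj_simple g s r : s \in S -> r \in S -> g ** a s = a r ->
  (g * s * g^-1 = r)%g.
Proof.
move=> sS rS E; apply: faithful => v.
by rewrite !actM (act_simple _ sS) (act_simple _ rS) -act_reflection E actVK.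
Qed.

(** * Coordinates with respect to the simple roots *)

Lemma dual_basis : exists f : W -> 'rV[R]_n,
  {in S &, forall s r, (f s *m a r) 0 0 = (s == r)%:R}.
Proof.
pose B : 'M[R]_(#|S|, n) := \matrix_(i, j) a (enum_val i) j 0.
have Bfree : row_free B.
  apply/inj_row_free => c cB.
  have E : \sum_(s in S) (if insub (index s (enum S)) is Some i then c 0 i else 0)
     *: a s = 0.
    rewrite big_enum_val /=; apply/matrixP => i j; rewrite ord1 summxE.
    have /= := congr1 (fun M : 'rV[R]_n => M 0 i) cB; rewrite !mxE => E.
    rewrite -[RHS]E; apply: eq_bigr => k _; rewrite !mxE; congr (_ * _).
    have -> : index (enum_val k) (enum S) = k.
      by rewrite index_uniq ?enum_uniq -?cardE //.
    by rewrite valK.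
  apply/matrixP => i k; rewrite ord1 mxE.
  have := rs_simple_free E (enum_valP k).
  by rewrite index_uniq ?enum_uniq -?cardE // valK.
(* The rows of [B] are free, so [pinvmx B] is a right inverse of [B] and its columns are dual to the
   simple roots. *)
pose T := (pinvmx B)^T.
have TB : T *m B^T = 1%:M.
  by rewrite -trmx_mul -[B in B *m _]mul1mx mulmxKp // trmx1.
exists (fun s => if insub (index s (enum S)) is Some i then row i T else 0).
have idx s (sS : s \in S) : (index s (enum S) < #|S|)%N.
  by rewrite cardE index_mem mem_enum.
move=> s r sS rS; rewrite (insubT (fun i => i < #|S|)%N (idx s sS)) /=.
have -> : a r = col (Ordinal (idx r rS)) B^T.
  apply/matrixP => i j; rewrite ord1 !mxE; congr (a _ _ _).
  by rewrite (enum_val_nth r) nth_index ?mem_enum.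
rewrite -row_mul colE mulmxA -colE TB !mxE; congr (nat_of_bool _)%:R.
apply/eqP/eqP => [/(congr1 val) /= E|E]; last by apply: val_inj; rewrite /= E.
by rewrite -(nth_index s (s := enum S) (x := s)) ?mem_enum // E nth_index ?mem_enum.
Qed.

(** The simple roots need not span the space, so [co s] is some linear extension of the coefficient
    of [a s]. *)
Definition co s v : R := (projT1 (cid dual_basis) s *m v) 0 0.

Lemma co_simple s r : s \in S -> r \in S -> co s (a r) = (s == r)%:R.
Proof. exact: (projT2 (cid dual_basis)). Qed.

Lemma coD s v b : co s (v + b) = co s v + co s b.
Proof. by rewrite /co mulmxDr mxE. Qed.

Lemma coN s v : co s (- v) = - co s v.
Proof. by rewrite /co mulmxN mxE. Qed.

Lemma coZ s k v : co s (k *: v) = k * co s v.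
Proof. by rewrite /co -scalemxAr mxE. Qed.

Lemma co_sum s (Q : pred W) (F : W -> R) (G : W -> 'cV[R]_n) :
  co s (\sum_(r | Q r) F r *: G r) = \sum_(r | Q r) F r * co s (G r).
Proof.
rewrite /co mulmx_sumr summxE; apply: eq_bigr => r _.
by rewrite -scalemxAr mxE.
Qed.

Lemma co_comb s (F : W -> R) : s \in S ->
  co s (\sum_(r in S) F r *: a r) = F s.
Proof.
move=> sS; rewrite co_sum (bigD1 s) //= co_simple // eqxx mulr1.
rewrite big1 ?addr0 // => r /andP[rS rs]; rewrite co_simple //.
by rewrite eq_sym (negbTE rs) mulr0.
Qed.

Lemma root_expand v : root v -> v = \sum_(s in S) co s v *: a s.
Proof.
have E F : v = \sum_(s in S) F s *: a s -> v = \sum_(s in S) co s v *: a s.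
  by move=> vE; rewrite {1}vE; apply: eq_bigr => s sS; rewrite vE co_comb.
case/(rs_simple_sign)=> [[F _ /E //]|[F _ vE]].
apply: (E (fun s => - F s)); rewrite -[v]opprK vE -sumrN.
by apply: eq_bigr => s _; rewrite scaleNr.
Qed.

(** * Positive and negative roots *)

Definition pos v := root v && [forall s in S, 0 <= co s v].

Lemma posP v : reflect (root v /\ {in S, forall s, 0 <= co s v}) (pos v).
Proof. by apply: (iffP andP) => -[rv /forall_inP]. Qed.

Lemma pos_root v : pos v -> root v.
Proof. by case/andP. Qed.

Lemma pos_nonneg_comb v : root v -> (nonneg_comb C a v <-> pos v).
Proof.
move=> rv; split=> [[F F0 vE]|/posP[_ v0]].
  by apply/posP; split=> // s sS; rewrite vE co_comb // F0.
by exists (co^~ v); last exact: root_expand.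
Qed.

Lemma pos_or_neg v : root v -> pos v \/ pos (- v).
Proof.
move=> rv; case: (rs_simple_sign rv) => /pos_nonneg_comb H; [left|right];
  by apply: H; rewrite ?rootN.
Qed.

Lemma pos_neg v : pos v -> pos (- v) -> False.
Proof.
case/posP=> rv v0 /posP[_ v1]; have := root_neq0 rv; rewrite (root_expand rv).
rewrite big1 ?eqxx // => s sS; apply/eqP; rewrite scaler_eq0 eq_le v0 //.
by have := v1 s sS; rewrite coN oppr_ge0 => ->.
Qed.

Lemma negP_pos v : root v -> (~~ pos v) = pos (- v).
Proof.
move=> rv; apply/idP/idP => [nv|nv]; first by case: (pos_or_neg rv) nv => [->|].
by apply/negP => pv; apply: (pos_neg pv).
Qed.

Lemma co_gt0_pos v s : root v -> s \in S -> 0 < co s v -> pos v.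
Proof.
move=> rv sS v0; case: (pos_or_neg rv) => // /posP[_ /(_ s sS)].
by rewrite coN oppr_ge0 leNgt v0.
Qed.

Lemma simple_pos s : s \in S -> pos (a s).
Proof.
move=> sS; apply/posP; split=> [|r rS]; first exact: rs_simple_root.
by rewrite co_simple // ler0n.
Qed.

Lemma simple_inj : {in S &, injective a}.
Proof.
move=> s r sS rS E; have := co_simple sS rS; rewrite -E co_simple // eqxx.
by case: eqP => // _ /eqP; rewrite oner_eq0.
Qed.

(** Each letter of [g] is a reflection that changes a vector by a multiple of some [a r] with [r] in
    [I]. *)
Lemma co_act_out s I g v : I \subset S -> s \in S -> s \notin I ->
  g \in <<I>> -> co s (g ** v) = co s v.
Proof.
move=> IS sS sI; move: g; apply: gen_ind => [|r w rI IH]; first by rewrite act1.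
have rS := subsetP IS _ rI.
rewrite actM (act_simple _ rS) /reflection coD coN coZ IH co_simple //.
by case: eqP sI rI => [-> /negP//|_ _ _]; rewrite mulr0 subr0.
Qed.

(* v lies in the span of the simple roots indexed by I (for v a root). *)
Definition inspan I v := [forall s in S, (s \notin I) ==> (co s v == 0)].

Lemma inspanP I v :
  reflect {in S, forall s, s \notin I -> co s v = 0} (inspan I v).
Proof.
apply: (iffP forall_inP) => H s sS; first by move=> sI; apply/eqP/(implyP (H s sS)).
by apply/implyP => sI; apply/eqP/H.
Qed.

Lemma inspanN I v : inspan I (- v) = inspan I v.
Proof.
by apply: eq_forallb_in => s _; rewrite coN oppr_eq0.
Qed.

Lemma inspan_simple I s : I \subset S -> s \in I -> inspan I (a s).
Proof.
move=> IS sI; apply/inspanP => r rS rI; rewrite co_simple ?(subsetP IS s) //.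
by case: eqP => // E; rewrite E sI in rI.
Qed.

Lemma inspan_expand I v : I \subset S -> root v -> inspan I v ->
  v = \sum_(s in I) co s v *: a s.
Proof.
move=> IS rv /inspanP v0; rewrite {1}(root_expand rv) (big_setID I) /=.
rewrite [X in _ + X]big1 => [|s]; last first.
  by rewrite inE => /andP[sI sS]; rewrite v0 ?scale0r.
by rewrite addr0 (setIidPr IS).
Qed.

Lemma inspan_act I g v : I \subset S -> g \in <<I>> ->
  inspan I (g ** v) = inspan I v.
Proof.
move=> IS gI; apply: eq_forallb_in => s sS; case: (boolP (s \in I)) => //= sI.
by rewrite (co_act_out _ IS).
Qed.

(** Some coordinate of [v] outside [I] is positive and [g] leaves it unchanged; one positive
    coordinate makes a root positive. *)
Lemma pos_act_out I g v : I \subset S -> g \in <<I>> -> pos v ->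
  ~~ inspan I v -> pos (g ** v).
Proof.
move=> IS gI /posP[rv v0]; rewrite negb_forall_in => /exists_inP[s sS].
rewrite negb_imply => /andP[sI v1]; apply: (@co_gt0_pos _ s) => //.
  exact: act_root.
by rewrite (co_act_out _ IS) // lt_neqAle eq_sym v1 v0.
Qed.

(* x is the minimal representative of x <<I>>. *)
Definition minrep I x := [forall s in I, pos (x ** a s)].

Lemma minrep_pos I x v : I \subset S -> minrep I x -> pos v -> inspan I v ->
  pos (x ** v).
Proof.
move=> IS /forall_inP xI /posP[rv v0] vI; apply/posP; split; first exact: act_root.
move=> s sS; rewrite (inspan_expand IS rv vI) act_sum co_sum.
apply: sumr_ge0 => r rI; rewrite mulr_ge0 ?v0 ?(subsetP IS) //.
by case/posP: (xI r rI) => _ ->.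
Qed.

Lemma minrep_pos_iff I x v : I \subset S -> minrep I x -> root v ->
  inspan I v -> pos (x ** v) = pos v.
Proof.
move=> IS xI rv vI; apply/idP/idP => [xv|pv]; last exact: minrep_pos xI _ _.
case: (pos_or_neg rv) => // nv; case: (pos_neg xv).
by rewrite -actN; apply: (minrep_pos IS xI nv); rewrite inspanN.
Qed.

Lemma neg_act I x v : I \subset S -> {in I, forall s, pos (- (x ** a s))} ->
  pos v -> inspan I v -> pos (- (x ** v)).
Proof.
move=> IS xI /posP[rv v0] vI; apply/posP; split; first exact/rootN/act_root.
move=> s sS; rewrite (inspan_expand IS rv vI) act_sum coN co_sum -sumrN.
apply: sumr_ge0 => r rI; rewrite -mulrN -coN mulr_ge0 ?v0 ?(subsetP IS) //.
by case/posP: (xI r rI) => _ ->.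
Qed.

Lemma simple_line s v k : s \in S -> pos v -> v = k *: a s -> v = a s.
Proof.
move=> sS /posP[rv v0] vE; have := rs_simple_root Phi sS.
move: rv; rewrite vE => rk /rs_reduced/(_ rk)[->|k1]; first by rewrite scale1r.
have := v0 s sS; rewrite vE coZ co_simple // eqxx mulr1 k1 ler0N1 //.
Qed.

Lemma pos_act_simple s v : s \in S -> pos v -> v != a s -> pos (s ** v).
Proof.
move=> sS pv vs; have IS : [set s] \subset S by rewrite sub1set.
apply: (pos_act_out IS) => //; first by rewrite mem_gen // set11.
apply: contra vs => /(inspan_expand IS (pos_root pv)); rewrite big_set1.
by move=> /(simple_line sS pv) ->.
Qed.

Lemma neg_act_simple s v : s \in S -> pos v -> pos (- (s ** v)) -> v = a s.
Proof.
move=> sS pv nv; apply/eqP; apply: contraT => /(pos_act_simple sS pv) pv'.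
by case: (pos_neg pv').
Qed.

(** * Inversions and length *)

Lemma mem_inv w b : (b \in inversions Phi w) = pos b && pos (- (w^-1%g ** b)).
Proof.
have P v : (v \in pos_roots Phi) = pos v.
  rewrite !inE /=; case rv: (root v); last by rewrite /pos rv.
  by apply/asboolP/idP => /(pos_nonneg_comb rv).
rewrite in_fsetI P; case: (pos b) => //=; apply/imfsetP/idP => /= [[v pv ->]|pv].
  by rewrite -/(act _ _) actK opprK -P.
by exists (- (w^-1%g ** b)); rewrite ?P // opprK -/(act _ _) actVK.
Qed.

Notation N := (inversions Phi).
Notation nl w := (#|` N w|)%fset.

Lemma le_invP u w :
  reflect (forall b, pos b -> pos (- (u^-1%g ** b)) -> pos (- (w^-1%g ** b)))
          (N u `<=` N w)%fset.
Proof.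
apply: (iffP (@fsubsetP _ (N u) (N w))) => H b; last first.
  by rewrite !mem_inv => /andP[pb ub]; rewrite pb H.
by move=> pb ub; have := H b; rewrite !mem_inv pb ub => /(_ isT).
Qed.

Lemma inv_mulr_simple w s : s \in S -> pos (w ** a s) ->
  N (w * s)%g = (w ** a s |` N w)%fset.
Proof.
move=> sS ps; apply/fsetP => b; rewrite in_fset1U !mem_inv invMg (gens_inv sS) actM.
case: eqVneq => [->|bs] /=.
  by rewrite ps actK act_simple_self // opprK simple_pos.
case pb: (pos b) => //=; have rb : root (w^-1%g ** b) by exact/act_root/pos_root.
apply/idP/idP => H; last first.
  rewrite -actN pos_act_simple //; apply/eqP => E.
  by apply: (pos_neg pb); rewrite -(actVK w b) -actN E.
case: (pos_or_neg rb) => // rb'; case/eqP: bs.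
by rewrite -(neg_act_simple sS rb' H) actVK.
Qed.

Lemma nl_mulr_simple w s : s \in S -> pos (w ** a s) -> nl (w * s)%g = (nl w).+1.
Proof.
move=> sS ps; rewrite inv_mulr_simple // cardfsU1 mem_inv ps actK.
by case: (boolP (pos (- a s))) => // /(pos_neg (simple_pos sS)).
Qed.

Lemma inv1 : N 1%g = fset0.
Proof.
apply/fsetP => b; rewrite mem_inv invg1 act1 in_fset0.
by apply/negP => /andP[/pos_neg].
Qed.

Notation wprod t := (\prod_(s <- t) s)%g.

(** Reading from the right, the image of [a s] turns negative at some letter [r]. Just before, it
    equals [a r], so deleting that letter amounts to multiplying by [s] on the right. *)
Lemma exchange (t : seq W) s : all [in S] t -> s \in S ->
  pos (- (wprod t ** a s)) ->
  exists t', [/\ all [in S] t', (size t').+1 = size t & wprod t' = (wprod t * s)%g].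
Proof.
move=> tS sS; elim: t tS => [_|r t IH /= /andP[rS tS]].
  by rewrite big_nil act1 => /(pos_neg (simple_pos sS)).
rewrite big_cons actM; have rt : root (wprod t ** a s).
  exact/act_root/rs_simple_root.
case: (pos_or_neg rt) => [pt nrt|nt _].
  exists t; split=> //; rewrite -(conj_simple sS rS (neg_act_simple rS pt nrt)).
  by rewrite mulgKV -mulgA gens_invol // mulg1.
have [t' [t'S <- E]] := IH tS nt; exists (r :: t'); split=> //=.
  by rewrite rS.
by rewrite big_cons E mulgA.
Qed.

(** A new last letter either adds one inversion or, by [exchange], cancels against an earlier
    letter. *)
Lemma word_length (t : seq W) : all [in S] t ->
  nl (wprod t) = size t \/
  exists t', [/\ all [in S] t', (size t' < size t)%N & wprod t' = wprod t].
Proof.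
elim/last_ind: t => [_|t s IH]; first by left; rewrite big_nil inv1 cardfs0.
rewrite all_rcons => /andP[sS tS]; rewrite size_rcons -cats1 big_cat big_seq1 /=.
have [lt|[t' [t'S lt E]]] := IH tS; last first.
  right; exists (rcons t' s); split; rewrite ?all_rcons ?sS ?size_rcons //.
  by rewrite -cats1 big_cat big_seq1 /= E.
have rt : root (wprod t ** a s) by exact/act_root/rs_simple_root.
case: (pos_or_neg rt) => [pt|/(exchange tS sS)[t' [t'S <- E]]].
  by left; rewrite nl_mulr_simple // lt.
by right; exists t'; split=> //; rewrite ltnW.
Qed.

Lemma has_wordP w k :
  reflect (exists t : seq W, [/\ size t = k, all [in S] t & wprod t = w])
          (has_word C w k).
Proof.
apply: (iffP existsP) => [[t /andP[tS /eqP tw]]|[t [/eqP tk tS tw]]].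
  by exists t; rewrite size_tuple.
by exists (Tuple tk); rewrite /is_word tS tw /=.
Qed.

Lemma ell_inv w : ell C w = nl w.
Proof.
rewrite /ell; case: ex_minnP => k /has_wordP[t [<- tS <-]] kmin.
have [->//|[t' [t'S lt E]]] := word_length tS.
have := kmin (size t'); rewrite leqNgt lt => /(_ _)/negP; case => //.
by apply/has_wordP; exists t'.
Qed.

Lemma mem_descR w s : (s \in descR C w) = (s \in S) && pos (- (w ** a s)).
Proof.
rewrite inE; case sS: (s \in S) => //=; rewrite !ell_inv.
have rs : root (w ** a s) by exact/act_root/rs_simple_root.
case: (pos_or_neg rs) => [ps|ns].
  rewrite nl_mulr_simple // ltnNge leqnSn; apply/esym/negP => ns.
  exact: (pos_neg ps ns).
have E : w = (w * s * s)%g by rewrite -mulgA gens_invol // mulg1.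
have ps : pos ((w * s)%g ** a s) by rewrite actM act_simple_self // actN.
by rewrite ns [in X in (_ < X)%N]E (nl_mulr_simple sS ps) ltnSn.
Qed.

Lemma descR_sub w : descR C w \subset S.
Proof. by apply/subsetP => s; rewrite mem_descR => /andP[]. Qed.

Lemma nl_eq0 w : nl w = 0%N -> w = 1%g.
Proof.
move=> w0; have := ell_inv w; rewrite w0 /ell; case: ex_minnP => k.
by case/has_wordP=> [[|r t] [<- _ <-]] // _; rewrite big_nil.
Qed.

Lemma minrep_gens w : minrep S w -> w = 1%g.
Proof.
move=> wS; apply: nl_eq0; apply/eqP; rewrite cardfs_eq0; apply/eqP/fsetP => b.
rewrite mem_inv in_fset0; apply/negP => /andP[pb nb]; apply: (pos_neg pb).
rewrite -{1}(actVK w b) -actN; apply: (minrep_pos _ wS) => //.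
by apply/inspanP => s ->.
Qed.

Lemma exists_neg_simple w : w != 1%g -> exists2 s, s \in S & pos (- (w ** a s)).
Proof.
apply: contra_neqP => H; apply: minrep_gens; apply/forall_inP => s sS.
have rs : root (w ** a s) by exact/act_root/rs_simple_root.
by case: (pos_or_neg rs) => // ns; case: H; exists s.
Qed.

(** * Parabolic subgroups *)

Lemma root_simple w s : s \in S -> root (w ** a s).
Proof. by move=> sS; apply/act_root/rs_simple_root. Qed.

Lemma descR_parab J w : J \subset S -> w \in <<J>> -> descR C w \subset J.
Proof.
move=> JS wJ; apply/subsetP => s; rewrite mem_descR => /andP[sS ns].
apply: contraT => sJ; case: (@pos_neg (w ** a s)) => //.
apply: (co_gt0_pos (root_simple w sS) sS).
by rewrite (co_act_out _ JS) // co_simple // eqxx.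
Qed.

Lemma nl_descR w s : s \in descR C w -> (nl (w * s)%g < nl w)%N.
Proof. by rewrite inE !ell_inv => /andP[]. Qed.

Lemma minrep_descR I x : I \subset S -> minrep I x = [disjoint descR C x & I].
Proof.
move=> IS; rewrite disjoint_sym disjoint_subset.
apply/forall_inP/subsetP => xI s sI; have sS := subsetP IS s sI.
  by rewrite inE mem_descR sS /= -negP_pos ?root_simple // negbK xI.
have := xI s sI; rewrite inE mem_descR sS /=.
by rewrite -negP_pos ?root_simple // negbK.
Qed.

(** Take [y] minimizing the length of [w * y^-1]: a descent of [w * y^-1] in [J] could be moved into
    [y]. *)
Lemma parab_decomp J w : J \subset S ->
  exists x y, [/\ w = (x * y)%g, y \in <<J>> & minrep J x].
Proof.
move=> JS; pose P y := y \in <<J>>.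
have P1 : P 1%g by exact: group1.
case: (@arg_minnP W 1%g P (fun y => nl (w * y^-1)%g) P1) => y yJ ymin.
exists (w * y^-1)%g, y; split=> //; first by rewrite mulgKV.
rewrite minrep_descR // -setI_eq0; apply: contraT => /set0Pn[s].
rewrite inE => /andP[/nl_descR lt sJ].
have := ymin (s * y)%g; rewrite leqNgt invMg mulgA (gens_inv (subsetP JS s sJ)).
by rewrite lt => H; apply: H; rewrite /P groupM // mem_gen.
Qed.

(** Otherwise [y * y'^-1] makes some [a s] with [s] in [J] negative, and so does
    [x' = x * y * y'^-1], by minimality of [x]. *)
Lemma minrep_uniq J x y x' y' : J \subset S -> y \in <<J>> -> y' \in <<J>> ->
  minrep J x -> minrep J x' -> (x * y = x' * y')%g -> y = y'.
Proof.
move=> JS yJ y'J xJ x'J E; apply/eqP; rewrite eq_mulgV1.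
have gJ : (y * y'^-1)%g \in <<J>> by rewrite groupM // groupV.
apply: contraT => /exists_neg_simple[s sS ns].
have sJ : s \in J by apply: (subsetP (descR_parab JS gJ)); rewrite mem_descR sS.
have := minrep_pos JS xJ ns; rewrite inspanN (inspan_act _ JS) //.
move=> /(_ (inspan_simple JS sJ)); rewrite actN -actM mulgA E mulgK.
by move/forall_inP: x'J => /(_ s sJ)/pos_neg.
Qed.

Lemma parab_partP J w : J \subset S ->
  parab_part C w J \in <<J>> /\ minrep J (w * (parab_part C w J)^-1)%g.
Proof.
move=> JS; have [x [y [-> yJ xJ]]] := parab_decomp w JS.
rewrite /parab_part; case: pickP => /= [z|/(_ y)].
  by rewrite inE -minrep_descR // => /andP[].
by rewrite yJ mulgK inE -minrep_descR // xJ.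
Qed.

Lemma parab_partE J x y : J \subset S -> y \in <<J>> -> minrep J x ->
  parab_part C (x * y)%g J = y.
Proof.
move=> JS yJ xJ; have [zJ wJ] := parab_partP (x * y)%g JS.
by apply: (minrep_uniq JS zJ yJ wJ xJ); rewrite mulgKV.
Qed.

Lemma supp_sub w J : J \subset S -> (supp C w \subset J) = (w \in <<J>>).
Proof.
move=> JS; apply/idP/idP => [sJ|].
  have : has_word C w (ell C w) by rewrite /ell; case: ex_minnP.
  case/existsP => t /andP[tS /eqP tw]; rewrite -tw.
  rewrite big_seq; apply: group_prod => s st; apply/mem_gen/(subsetP sJ).
  by rewrite inE; apply/existsP; exists t; rewrite /is_word tS tw eqxx.
move=> wJ; apply/subsetP => s; rewrite inE => /existsP[[t tn]].
rewrite /is_word /= => /andP[/andP[tS /eqP tw] st].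
have {st} : s \in t by exact: st.
move/eqP: tn; rewrite ell_inv => tn.
(* The last letter [r] of a reduced word is a descent of [w], hence in [J]; the other letters form a
   reduced word of [w * r]. *)
elim/last_ind: t => // t r IH in w wJ tn tS tw *.
move: tS tn tw; rewrite all_rcons size_rcons => /andP[rS tS] tn.
rewrite -cats1 big_cat big_seq1 cats1 /= => tw; have Ew : (w * r)%g = wprod t.
  by rewrite -tw -mulgA gens_invol // mulg1.
have rd : r \in descR C w.
  rewrite inE rS !ell_inv -tn Ew ltnS.
  by rewrite -ell_inv /ell; case: ex_minnP => k _; apply; apply/has_wordP; exists t.
have rJ := subsetP (descR_parab JS wJ) r rd.
have rn : pos ((w * r)%g ** a r).
  by rewrite actM act_simple_self // actN; move: rd; rewrite mem_descR => /andP[].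
have wrJ : (w * r)%g \in <<J>> by rewrite groupM // mem_gen.
rewrite mem_rcons inE => /predU1P[->//|]; apply: (IH _ wrJ) => //.
have E : w = (w * r * r)%g by rewrite -mulgA gens_invol // mulg1.
by move: tn; rewrite [in nl w]E (nl_mulr_simple rS rn) => -[].
Qed.

Lemma supp_gens w : supp C w \subset S.
Proof. by rewrite supp_sub // in_gen_gens. Qed.

(** The reflection negates its root [g ** a s], while elements of [<<J>>] fix all coordinates
    outside [J]. *)
Lemma refl_inspan J g s : J \subset S -> s \in S ->
  (g * s * g^-1)%g \in <<J>> -> inspan J (g ** a s).
Proof.
move=> JS sS gJ; apply/inspanP => r rS rJ.
have := co_act_out (g ** a s) JS rS rJ gJ.
rewrite actM actK actM act_simple_self // actN coN => /eqP.
by rewrite eq_sym -addr_eq0 -mulr2n mulrn_eq0 => /eqP.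
Qed.

(** A simple root spans an extreme ray of the cone of positive roots. Expanding [v] over [I] writes
    [a s] as a nonnegative combination of the positive roots [k *: (g ** a r)], so every term that
    occurs is [a s] itself up to a scalar. *)
Lemma simple_preim I g k v s : I \subset S ->
  {in I, forall r, pos (k *: (g ** a r))} -> pos v -> inspan I v -> s \in S ->
  k *: (g ** v) = a s -> exists2 r, r \in I & v = a r.
Proof.
move=> IS gI pv vI sS E; have /posP[rv v0] := pv.
have k0 : k != 0.
  by apply: contraTneq (simple_neq0 sS) => k0; rewrite -E k0 scale0r negbK.
have [r rI vr] : exists2 r, r \in I & co r v != 0.
  apply/exists_inP; apply: contraT; rewrite negb_exists_in => /forall_inP H.
  have := root_neq0 rv; rewrite (inspan_expand IS rv vI) big1 ?eqxx // => r rI.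
  by move/(_ r rI): H; rewrite negbK => /eqP ->; rewrite scale0r.
exists r => //; apply: (@act_inj g); apply: (scalerI k0); rewrite E.
apply/esym; have pr := gI r rI.
apply: (simple_line (k := co s (k *: (g ** a r))) sS pr).
rewrite {1}(root_expand (pos_root pr)) (bigD1 s) //= big1 ?addr0 // => t.
case/andP => tS ts; suff -> : co t (k *: (g ** a r)) = 0 by rewrite scale0r.
have : co t (a s) = 0 by rewrite co_simple // (negbTE ts).
rewrite -E {1}(inspan_expand IS rv vI) act_sum scaler_sumr.
under eq_bigr => q _ do rewrite scalerA mulrC -scalerA.
rewrite co_sum => /eqP; rewrite psumr_eq0 => [/allP/(_ r (mem_index_enum r))|q qI].
  by rewrite rI mulf_eq0 (negbTE vr) /= => /eqP.
by case/posP: (gI q qI) => _ g0; rewrite mulr_ge0 ?g0 ?v0 // (subsetP IS).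
Qed.

(** * Descents of products *)

(* Equivalent to N u being contained in N (u * c): lengths add up in u * c. *)
Definition ladd u c :=
  forall b, pos b -> pos (- (u ** b)) -> pos (c^-1%g ** b).

Lemma le_ladd u t : (N u `<=` N t)%fset -> ladd u (u^-1 * t)%g.
Proof.
move=> /le_invP le b pb nb; rewrite invMg invgK actM.
by have := le _ nb; rewrite !actN actK !opprK => /(_ pb).
Qed.

(** Otherwise [u] makes the positive root [- (c ** b)] negative, and [ladd] makes its image [- b]
    under [c^-1] positive. *)
Lemma ladd_neg u c b : ladd u c -> pos b -> pos (- (c ** b)) ->
  pos (- ((u * c)%g ** b)).
Proof.
move=> add pb nb; rewrite actM; have rb : root (u ** c ** b).
  exact/act_root/act_root/pos_root.
case: (pos_or_neg rb) => // p; have := add _ nb; rewrite !actN opprK actK.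
by move=> /(_ p)/(pos_neg pb).
Qed.

Lemma ladd_pos u c b : ladd u c -> pos b -> pos ((u * c)%g ** b) ->
  pos (c ** b).
Proof.
move=> add pb p; case: (pos_or_neg (act_root c (pos_root pb))) => // /(ladd_neg add pb).
by move=> /(pos_neg p).
Qed.

(** With [t = u * c], every lower wall [u ** a e] of the chamber of [u] is also a wall [t ** a i] of
    the chamber of [t]. *)
Definition desc_lift u c :=
  forall e, e \in descR C u -> exists2 i, i \in S & c ** a i = a e.

Lemma minrep_neg I x v : I \subset S -> minrep I x -> root v ->
  inspan I v -> pos (- (x ** v)) = pos (- v).
Proof.
by move=> IS xI rv vI; rewrite -actN (minrep_pos_iff IS xI) ?rootN // inspanN.
Qed.

(** * Removing a parabolic right factor from [c2 * cM] *)

Section FactorRight.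

Variables (M : {set W}) (u c2 cM : W).
Hypotheses (MS : M \subset S) (cMM : cM \in <<M>>) (c2M : minrep M c2).

Lemma factor_simple i e : i \in M -> e \in S -> (c2 * cM)%g ** a i = a e ->
  exists2 m, m \in M & cM ** a i = a m.
Proof.
move=> iM eS; rewrite actM => E; have iS := subsetP MS i iM.
have di : inspan M (cM ** a i) by rewrite inspan_act // inspan_simple.
have ri := root_simple cM iS.
apply: (simple_preim (g := c2) (k := 1) (s := e)) => //; rewrite ?scale1r //.
  by move=> r rM; rewrite scale1r; move/forall_inP: c2M; apply.
by rewrite -(minrep_pos_iff MS c2M) // E simple_pos.
Qed.

(** Suppose [c2^-1 ** b] is negative. In the span of [M], minimality of [c2] would make [b]
    negative; outside it, [cM^-1] keeps the sign, against the hypothesis. *)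
Lemma factor_ladd : ladd u (c2 * cM)%g -> ladd u c2.
Proof.
move=> add b pb nb; have rb := pos_root pb.
case: (pos_or_neg (act_root c2^-1%g rb)) => // nc.
case: (boolP (inspan M (c2^-1%g ** b))) => [di|nd].
  have := minrep_pos MS c2M nc; rewrite inspanN di => /(_ isT).
  by rewrite actN actVK => /(pos_neg pb).
have cMV : cM^-1%g \in <<M>> by rewrite groupV.
have := pos_act_out MS cMV nc; rewrite inspanN nd => /(_ isT).
rewrite actN -actM -invMg => n'; have := add b pb nb.
by move=> /pos_neg - /(_ n').
Qed.

(** The inversions of [c2] remain, and a descent [m] of [cM^-1] yields the new one [c2 ** a m]. *)
Lemma factor_inv : cM != 1%g -> (nl c2 < nl (c2 * cM)%g)%N.
Proof.
move=> cM1; apply: fproper_ltn_card; rewrite fproperE; apply/andP; split.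
  apply/le_invP => b pb nb; rewrite invMg actM -actN.
  apply: (pos_act_out MS) => //; first by rewrite groupV.
  apply/negP => /(minrep_pos MS c2M nb).
  by rewrite actN actVK => /(pos_neg pb).
apply/negP => /le_invP le.
have cMV : cM^-1%g \in <<M>> by rewrite groupV.
have : cM^-1%g != 1%g by rewrite invg_eq1.
case/exists_neg_simple => m mS nm.
have mM : m \in M by apply: (subsetP (descR_parab MS cMV)); rewrite mem_descR mS.
have pm : pos (c2 ** a m) by move/forall_inP: c2M; apply.
have := le _ pm; rewrite invMg !actM actK => /(_ nm).
by move=> /(pos_neg (simple_pos mS)).
Qed.

Lemma factor_neq1 j : j \in M -> pos (- ((c2 * cM)%g ** a j)) -> cM != 1%g.
Proof.
move=> jM; apply: contraTneq => ->; rewrite mulg1; apply/negP => nj.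
by move/forall_inP: c2M => /(_ j jM)/pos_neg.
Qed.

Lemma factor_desc : (forall i e, e \in descR C u -> i \in S ->
    (c2 * cM)%g ** a i = a e -> i \in M) ->
  desc_lift u (c2 * cM)%g -> desc_lift u c2.
Proof.
move=> IM lift e eu; have [i iS E] := lift e eu.
have [m mM Em] := factor_simple (IM i e eu iS E) (subsetP (descR_sub u) e eu) E.
by exists m; rewrite ?(subsetP MS) // -Em -actM.
Qed.

End FactorRight.

(* Induction on the length of c = c2 cM, where M consists of d, a descent of c
   and the simple roots mapped to those of D_R(u). By induction cM^-1 is negative
   on a m unless a m is one of the latter, so expanding cM (a d) in M shows that
   the coefficient of a d in a d = cM^-1 (cM (a d)) is at most 0. *)
Lemma desc_lift_descent u c d : ladd u c -> desc_lift u c -> d \in S ->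
  pos (- ((u * c)%g ** a d)) -> pos (c ** a d) ->
  exists2 e, e \in descR C u & c ** a d = a e.
Proof.
have [k] := ubnP (nl c); elim: k => // k IH in c d *; rewrite ltnS => ck.
move=> add lift dS nd pd; case: (eqVneq c 1%g) => [c1|].
  exists d; last by rewrite c1 act1.
  by rewrite mem_descR dS; move: nd; rewrite c1 mulg1.
case/exists_neg_simple => j jS nj.
pose I := [set i in S | [exists e in descR C u, c ** a i == a e]].
have IP i : i \in I -> exists2 e, e \in descR C u & c ** a i = a e.
  by rewrite inE => /andP[_ /exists_inP[e eu /eqP E]]; exists e.
case: (boolP (d \in I)) => [/IP //|dI].
pose M := d |: (j |: I).
have MS : M \subset S.
  by rewrite !subUset !sub1set dS jS; apply/subsetP => i; rewrite inE => /andP[].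
have [c2 [cM [Ec cMM c2M]]] := parab_decomp c MS.
have jM : j \in M by rewrite !inE eqxx orbT.
have dM : d \in M by rewrite !inE eqxx.
have cM1 : cM != 1%g by apply: (factor_neq1 c2M jM); rewrite -Ec.
have IH2 m : m \in M -> pos (- ((u * c2)%g ** a m)) ->
    exists2 i, i \in I & cM^-1%g ** a m = a i.
  move=> mM nm; have mS := subsetP MS m mM.
  have pm : pos (c2 ** a m) by move/forall_inP: c2M; apply.
  have lt : (nl c2 < k)%N by rewrite (leq_trans _ ck) // Ec (factor_inv MS).
  have [||e eu E] := IH c2 m lt _ _ mS nm pm.
  - by apply: (factor_ladd MS cMM c2M); rewrite -Ec.
  - apply: (factor_desc MS cMM c2M); rewrite -Ec // => i e eu iS E.
    rewrite !inE iS; apply/orP; right; apply/orP; right.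
    by apply/exists_inP; exists e => //; apply/eqP.
  have [i iS Ei] := lift e eu; exists i.
    by rewrite inE iS; apply/exists_inP; exists e => //; apply/eqP.
  by apply: (@act_inj (c2 * cM)%g); rewrite -Ec Ei Ec actM actVK.
have negM m : m \in M -> pos (- ((u * c)%g ** a m)).
  rewrite !inE => /or3P[/eqP -> //|/eqP ->|/andP[mS /exists_inP[e eu /eqP E]]].
    exact: (ladd_neg add (simple_pos jS)).
  by rewrite actM E; move: eu; rewrite mem_descR => /andP[].
have pcd : pos (cM ** a d).
  rewrite -(minrep_pos_iff MS c2M) ?root_simple -?actM -?Ec //.
  by rewrite inspan_act // inspan_simple.
have dd : inspan M (cM ** a d) by rewrite inspan_act // inspan_simple.
have : co d (a d) <= 0.
  rewrite -[a d](actK cM) (inspan_expand MS (pos_root pcd) dd) act_sum co_sum.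
  apply: sumr_le0 => m mM; have mS := subsetP MS m mM.
  rewrite mulr_ge0_le0 //; first by case/posP: pcd => _ ->.
  have rm : root ((u * c2)%g ** a m) by exact: root_simple.
  (* In the negative case the root is some [a i] with [i] in [I], and [d] is not in [I]. In the
     positive case [cM^-1 ** a m] cannot be positive: it lies in the span of [M], where [u * c]
     makes positive roots negative, and [u * c * cM^-1 = u * c2]. *)
  case: (pos_or_neg rm) => [pm|/(IH2 m mM)[i iI ->]]; last first.
    rewrite co_simple // ?(subsetP MS) //; last by rewrite !in_setU1 iI !orbT.
    by case: eqP iI dI => // -> ->.
  have rm' := root_simple cM^-1%g mS.
  case: (pos_or_neg rm') => [p|/posP[_ /(_ d dS)]]; last by rewrite coN oppr_ge0.
  have := neg_act MS negM p; rewrite inspan_act ?groupV // inspan_simple //.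
  move=> /(_ isT); rewrite -actM Ec !mulgA mulgK => n'.
  by case: (pos_neg pm).
by rewrite co_simple // eqxx ler10.
Qed.

(** * Localization in a parabolic subgroup *)

Lemma shardG_sub u (H : {group W}) :
  reflect {in descR C u, forall e, (u * e * u^-1)%g \in H} (shardG C u \subset H).
Proof.
rewrite /= gen_subG; apply: (iffP subsetP) => uH e; last first.
  by case/imsetP => s su ->; rewrite conjgE invgK mulgA uH.
by move=> eu; apply: uH; apply/imsetP; exists e => //; rewrite conjgE invgK mulgA.
Qed.

Lemma shardG_gen u e : e \in descR C u -> (u * e * u^-1)%g \in shardG C u.
Proof. by move=> eu; apply: (shardG_sub u (shardG C u) _). Qed.

Lemma shardG_desc u J : J \subset S -> u \in <<J>> -> shardG C u \subset <<J>>.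
Proof.
move=> JS uJ; apply/(@shardG_sub u <<J>>%G) => e eu.
by rewrite groupM ?groupV // groupM // mem_gen // (subsetP (descR_parab JS uJ)).
Qed.

(** Write [y = a1^-1 * b1^-1] with [a1] in [<<J>>] and [b1] minimal. A descent [s] of [b1^-1] has
    [b1^-1 ** a s] outside the span of [J], so it is a descent of [y]; its reflection then lies in
    [<<J>>], contradicting [refl_inspan]. *)
Lemma shardG_parab y J : J \subset S -> shardG C y \subset <<J>> -> y \in <<J>>.
Proof.
move=> JS /(@shardG_sub y <<J>>%G) yJ.
have [b1 [a1 [E a1J bJ]]] := parab_decomp y^-1%g JS.
have Ey : y = (a1^-1 * b1^-1)%g by rewrite -invMg -E invgK.
case: (eqVneq b1^-1%g 1%g) => [b11|]; first by rewrite Ey b11 mulg1 groupV.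
case/exists_neg_simple => s sS ns.
have nd : ~~ inspan J (b1^-1%g ** a s).
  apply/negP => d; have := minrep_pos JS bJ ns; rewrite inspanN => /(_ d).
  by rewrite actN actVK => /(pos_neg (simple_pos sS)).
have aJ : a1^-1%g \in <<J>> by rewrite groupV.
have := pos_act_out JS aJ ns; rewrite inspanN => /(_ nd).
rewrite actN -actM -Ey => ny; have sy : s \in descR C y by rewrite mem_descR sS.
case/negP: nd; apply: (refl_inspan JS sS).
have := yJ s sy; rewrite Ey !invMg !invgK => H.
have : (a1 * (a1^-1 * b1^-1 * s * (b1 * a1)) * a1^-1)%g \in <<J>>.
  by rewrite groupM // groupM.
by rewrite !mulgA mulgV mul1g mulgK.
Qed.

(* Here w = x * h, with x minimal in w <<D>>, bounds u from above. The elements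
   u, y and c correspond to each other in u * c = x * y, and y plays the role
   of u in the parabolic subgroup <<D>>. *)
Section Localize.

Variables (D : {set W}) (x h y u c : W).
Hypotheses (DS : D \subset S) (xD : minrep D x) (hD : h \in <<D>>).
Hypotheses (yD : y \in <<D>>) (cD : minrep D c) (Ec : (u * c = x * y)%g).
Hypotheses (uN : (N u `<=` N (x * h)%g)%fset).
Hypotheses (uG : shardG C u \subset (<<D>> :^ x^-1)%g).

(** Put [v = x^-1 ** b]. In the span of [D], minimality of [c] gives [u^-1 ** b] and [y^-1 ** v] the
    same sign; outside it, [h^-1] and [y^-1] both preserve the sign of [v]. *)
Lemma loc_le : (N u `<=` N (x * y)%g)%fset.
Proof.
apply/le_invP => b pb nb; have := le_invP _ _ uN b pb nb.
have yV : y^-1%g \in <<D>> by rewrite groupV.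
have hV : h^-1%g \in <<D>> by rewrite groupV.
have rv : root (x^-1%g ** b) by exact/act_root/pos_root.
rewrite !invMg !actM; move Ev: (x^-1%g ** b) rv => v rv hv.
case: (boolP (inspan D v)) => [dv|dv].
  move: nb; have -> : u^-1%g ** b = c ** y^-1%g ** v.
    by rewrite -Ev -!actM -mulgA -invMg -Ec invMg mulgA mulgV mul1g.
  by rewrite (minrep_neg DS cD) ?inspan_act // act_root.
have := pos_act_out DS hD hv; rewrite inspanN inspan_act // => /(_ dv).
rewrite actN actVK => nv; have := pos_act_out DS yV nv; rewrite inspanN.
by move=> /(_ dv); rewrite actN.
Qed.

Lemma loc_ladd : ladd u c.
Proof.
have -> : c = (u^-1 * (x * y))%g by rewrite -Ec mulKg.
exact/le_ladd/loc_le.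
Qed.

(** The hypothesis [uG] puts [c^-1 * e * c] in [<<D>>], so [c^-1 ** a e] lies in the span of [D]. It
    is positive by minimality of [c], and simple by [simple_preim]. *)
Lemma loc_lift e : e \in descR C u -> exists2 d, d \in D & c ** a d = a e.
Proof.
move=> eu; have eS := subsetP (descR_sub u) e eu.
have cE : (c^-1 * e * c^-1^-1)%g = (y^-1 * (x^-1 * (u * e * u^-1) * x) * y)%g.
  have -> : c = (u^-1 * (x * y))%g by rewrite -Ec mulKg.
  by rewrite !invMg !invgK !mulgA.
have de : inspan D (c^-1%g ** a e).
  have := subsetP uG _ (shardG_gen eu); rewrite mem_conjgV conjgE mulgA => uGe.
  by apply: refl_inspan => //; rewrite cE groupM // groupM ?groupV.
have [|||d dD E] := @simple_preim D c 1 (c^-1%g ** a e) e DS _ _ de eS.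
- by move=> r rD; rewrite scale1r; move/forall_inP: cD; apply.
- by rewrite -(minrep_pos_iff DS cD) ?root_simple // actVK simple_pos.
- by rewrite scale1r actVK.
by exists d => //; rewrite -E actVK.
Qed.

Lemma loc_lift_gens : desc_lift u c.
Proof. by move=> e /loc_lift[d dD E]; exists d; rewrite ?(subsetP DS). Qed.

Lemma loc_desc d : d \in descR C y -> exists2 e, e \in descR C u & c ** a d = a e.
Proof.
move=> dy; have dD := subsetP (descR_parab DS yD) d dy.
have dS := subsetP DS d dD; move: dy; rewrite mem_descR dS => nd.
apply: (desc_lift_descent loc_ladd loc_lift_gens) => //.
  rewrite Ec actM (minrep_neg DS xD) ?root_simple //.
  by rewrite inspan_act // inspan_simple.
by move/forall_inP: cD; apply.
Qed.

Lemma loc_desc_conv d e : d \in S -> e \in descR C u -> c ** a d = a e ->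
  d \in descR C y.
Proof.
move=> dS eu E; have [d' dD E'] := loc_lift eu.
have {d' E'} dD : d \in D.
  suff -> : d = d' by [].
  apply: simple_inj => //; first exact: (subsetP DS).
  by apply: (@act_inj c); rewrite E E'.
rewrite mem_descR dS -(minrep_neg DS xD) ?root_simple //.
  by rewrite -actM -Ec actM E; move: eu; rewrite mem_descR => /andP[].
by rewrite inspan_act // inspan_simple.
Qed.

Lemma loc_shardG : shardG C u :=: (shardG C y :^ x^-1)%g.
Proof.
have key d e : d \in S -> e \in S -> c ** a d = a e ->
    (e ^ u^-1 = (d ^ y^-1) ^ x^-1)%g.
  move=> dS eS E; rewrite -(conj_simple dS eS E) -conjgM -invMg -Ec invMg.
  by rewrite conjgM; congr (_ ^ _)%g; rewrite conjgE invgK mulgA.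
rewrite /= -genJ; congr <<_>>; apply/setP => g; apply/imsetP/imsetP.
  case=> e eu ->; have [d dD E] := loc_lift eu; have dS := subsetP DS d dD.
  have dy := loc_desc_conv dS eu E.
  exists (d ^ y^-1)%g; first by apply/imsetP; exists d.
  by apply: key => //; apply: (subsetP (descR_sub u)).
case=> _ /imsetP[d dy ->] ->; have [e eu E] := loc_desc dy.
exists e => //; apply/esym/key => //; first exact: (subsetP (descR_sub y)).
exact: (subsetP (descR_sub u)).
Qed.

End Localize.

(** If [x^-1 ** b] is negative, it is outside the span of [D] by minimality of [x], so [h^-1] keeps
    it negative. *)
Lemma mul_minrep_le D x y h : D \subset S -> minrep D x -> y \in <<D>> ->
  h \in <<D>> -> (N y `<=` N h)%fset -> (N (x * y)%g `<=` N (x * h)%g)%fset.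
Proof.
move=> DS xD yD hD /le_invP le; apply/le_invP => b pb.
rewrite !invMg !actM; have rv : root (x^-1%g ** b) by exact/act_root/pos_root.
case: (pos_or_neg rv) => [pv /(le _ pv) //|nv ny].
rewrite -actN; apply: (pos_act_out DS) => //; first by rewrite groupV.
apply/negP => /(minrep_pos DS xD nv).
by rewrite actN actVK => /(pos_neg pb).
Qed.

(** If [u^-1 * w] made [a s] negative, then [w ** a s], up to sign, would be an inversion of exactly
    one of [u] and [w]. *)
Lemma le_inv_anti u w : (N u `<=` N w)%fset -> (N w `<=` N u)%fset -> u = w.
Proof.
move=> /le_invP uw /le_invP wu; apply: (mulgI u^-1%g); rewrite mulVg.
apply/esym/minrep_gens/forall_inP => s sS; rewrite actM.
have := root_simple (u^-1 * w)%g sS; rewrite actM => /pos_or_neg[//|ns].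
case: (pos_or_neg (root_simple w sS)) => [pw|nw].
  by have := uw _ pw ns; rewrite actK => /(pos_neg (simple_pos sS)).
have := wu _ nw; rewrite !actN actK opprK => /(_ (simple_pos sS)).
by move=> /(pos_neg ns).
Qed.

Lemma inspan_inv J y b : J \subset S -> y \in <<J>> -> pos b ->
  pos (- (y^-1%g ** b)) -> inspan J b.
Proof.
move=> JS yJ pb nb; apply: contraT => dJ.
have yV : y^-1%g \in <<J>> by rewrite groupV.
by have /pos_neg/(_ nb) := pos_act_out JS yV pb dJ.
Qed.

Lemma neg_le D h y : D \subset S -> h \in <<D>> -> y \in <<D>> ->
  {in D, forall s, pos (- (h ** a s))} -> (N y `<=` N h)%fset.
Proof.
move=> DS hD yD hn; apply/le_invP => b pb nb.
have db := inspan_inv DS yD pb nb.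
have rh : root (h^-1%g ** b) by exact/act_root/pos_root.
case: (pos_or_neg rh) => // ph; have := neg_act DS hn ph.
rewrite inspan_act ?groupV // actVK => /(_ db) nb'.
by case: (pos_neg pb).
Qed.

(* u is a minimal element below x y having all the lower walls of x y indexed by
   D_R(y) among its inversions. *)
Lemma loc_surj D x y : D \subset S -> minrep D x -> y \in <<D>> ->
  exists u, [/\ (N u `<=` N (x * y)%g)%fset, shardG C u \subset (<<D>> :^ x^-1)%g
    & minrep D (u^-1 * (x * y))%g].
Proof.
move=> DS xD yD; set t := (x * y)%g.
pose P z := (N z `<=` N t)%fset && [forall i in descR C y, pos (z^-1%g ** t ** a i)].
have Pt : P t.
  rewrite /P fsubset_refl; apply/forall_inP => i; rewrite actK.
  by move/(subsetP (descR_sub y)); exact: simple_pos.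
case: (@arg_minnP W t P (fun z => nl z) Pt) => u /andP[ut /forall_inP ui] umin.
have add := le_ladd ut; set c := (u^-1 * t)%g in add *.
have uc : (u * c)%g = t by rewrite mulKVg.
have lift e : e \in descR C u -> exists2 i, i \in descR C y & c ** a i = a e.
  move=> eu; have eS := subsetP (descR_sub u) e eu.
  have ne : pos (- (u ** a e)) by move: eu; rewrite mem_descR eS.
  (* Since [u * e] is still below [t], it must lose the wall of some [i]. As [a e] is the only
     positive root that [e] makes negative, [c ** a i = a e]. *)
  have nP : ~~ P (u * e)%g by apply: contraL (nl_descR eu) => /umin; rewrite -leqNgt.
  have le : (N (u * e)%g `<=` N t)%fset.
    apply: fsubset_trans ut; rewrite -{2}[u]mulg1 -(gens_invol eS) mulgA.
    rewrite [X in (_ `<=` X)%fset]inv_mulr_simple ?fsubsetU1 //.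
    by rewrite actM act_simple_self // actN.
  move: nP; rewrite /P le /= => /forall_inPn[i iy].
  have pc : pos (c ** a i) by rewrite actM ui.
  rewrite invMg (gens_inv eS) -actM -mulgA actM -/c => np.
  exists i => //; apply: (neg_act_simple eS pc); rewrite -negP_pos //.
  exact/act_root/pos_root.
exists u; split=> //.
  apply/(@shardG_sub u (<<D>> :^ x^-1)%G) => e eu; have [i iy E] := lift e eu.
  have iD := subsetP (descR_parab DS yD) i iy; have iS := subsetP DS i iD.
  have eS := subsetP (descR_sub u) e eu.
  rewrite -(conj_simple iS eS E) mem_conjgV.
  have -> : ((u * (c * i * c^-1) * u^-1) ^ x = y * i * y^-1)%g.
    apply: (conjg_inj x^-1%g); rewrite -conjgM mulgV conjg1 conjgE invgK.
    have -> : (u * (c * i * c^-1) * u^-1 = (u * c) * i * (u * c)^-1)%g.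
      by rewrite (invMg u c) !mulgA.
    by rewrite uc invMg !mulgA.
  by rewrite groupM ?groupV // groupM // mem_gen.
apply/forall_inP => d dD; have dS := subsetP DS d dD.
case: (boolP (d \in descR C y)) => [dy|]; first by rewrite actM ui.
rewrite mem_descR dS -negP_pos ?root_simple // negbK => py.
apply: (ladd_pos add (simple_pos dS)).
rewrite uc actM; apply: (minrep_pos DS xD py).
by rewrite inspan_act // inspan_simple.
Qed.

(* Induction on the length of c: peeling off the part of c in the parabolic
   subgroup generated by a descent of c and the simple roots that c lifts from
   D_R(u') gives a smaller upper bound u' c2 of u', which is still above u. *)
Lemma le_of_shardG u u' c : (N u `<=` N (u' * c)%g)%fset ->
  (N u' `<=` N (u' * c)%g)%fset -> shardG C u \subset shardG C u' ->
  desc_lift u' c -> (N u `<=` N u')%fset.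
Proof.
move=> + + uG; have [k] := ubnP (nl c); elim: k => // k IH in c *; rewrite ltnS => ck.
case: (eqVneq c 1%g) => [->|]; first by rewrite mulg1.
case/exists_neg_simple => j jS nj ut ut' lift.
have add := le_ladd ut'; rewrite mulKg in add.
pose I := [set i in S | [exists e in descR C u', c ** a i == a e]].
have II i e : i \in S -> e \in descR C u' -> c ** a i = a e -> i \in I.
  by move=> iS eu E; rewrite inE iS; apply/exists_inP; exists e => //; apply/eqP.
pose M := j |: I.
have MS : M \subset S.
  by rewrite !subUset !sub1set jS; apply/subsetP => i; rewrite inE => /andP[].
have [c2 [cM [Ec cMM c2M]]] := parab_decomp c MS.
have [x [h [Et hM xM]]] := parab_decomp (u' * c)%g MS.
have jM : j \in M by rewrite !inE eqxx.
have IM i e : e \in descR C u' -> i \in S -> c ** a i = a e -> i \in M.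
  by move=> eu iS E; rewrite in_setU1 (II i e) ?orbT.
have cM1 : cM != 1%g by apply: (factor_neq1 c2M jM); rewrite -Ec.
have negM m : m \in M -> pos (- ((u' * c)%g ** a m)).
  rewrite !inE => /predU1P[->|/andP[mS /exists_inP[e eu /eqP E]]].
    exact: (ladd_neg add (simple_pos jS)).
  by rewrite actM E; move: eu; rewrite mem_descR => /andP[].
have hneg m : m \in M -> pos (- (h ** a m)).
  move=> mM; have := negM m mM; have mS := subsetP MS m mM.
  rewrite Et actM (minrep_neg MS xM) ?root_simple //.
  by rewrite inspan_act // inspan_simple.
(* Both [u] and [u'] are bounded by [x * h]. Localizing there turns [u'] into [y'] and [u] into
   [q^-1], whose inversions are to be compared. *)
pose y' := (h * cM^-1)%g.
have y'M : y' \in <<M>> by rewrite groupM // groupV.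
have Ey' : (u' * c2 = x * y')%g by rewrite mulgA -Et Ec -!mulgA mulgV mulg1.
have [p [q [Ep qM pM]]] := parab_decomp (u^-1 * x)%g MS.
have yM : q^-1%g \in <<M>> by rewrite groupV.
have Ey : (u * p = x * q^-1)%g.
  by apply: (mulIg q); rewrite mulgKV -mulgA -Ep mulKVg.
have uG' : shardG C u' \subset (<<M>> :^ x^-1)%g.
  apply/(@shardG_sub u' (<<M>> :^ x^-1)%G) => e eu; have [i iS E] := lift e eu.
  have iM := IM i e eu iS E; have eS := subsetP (descR_sub u') e eu.
  rewrite -(conj_simple iS eS E) mem_conjgV.
  have -> : ((u' * (c * i * c^-1) * u'^-1) ^ x = h * i * h^-1)%g.
    apply: (conjg_inj x^-1%g); rewrite -conjgM mulgV conjg1 conjgE invgK.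
    have -> : (u' * (c * i * c^-1) * u'^-1 = (u' * c) * i * (u' * c)^-1)%g.
      by rewrite invMg !mulgA.
    by rewrite Et invMg !mulgA.
  by rewrite groupM ?groupV // groupM // mem_gen.
have uGM := subset_trans uG uG'.
have ut'1 := ut'; rewrite Et in ut ut'1.
have lift2 : desc_lift u' c2.
  by apply: (factor_desc MS cMM c2M); rewrite -Ec // => i e eu iS; apply: IM.
have le' := loc_le MS hM y'M c2M Ey' ut'1.
have le := loc_le MS hM yM pM Ey ut.
have lt : (nl c2 < k)%N by rewrite (leq_trans _ ck) // Ec (factor_inv MS).
apply: (IH c2) => //; rewrite Ey' //; apply: (fsubset_trans le).
apply: (mul_minrep_le MS xM) => //.
(* The group of [q^-1] lies in that of [y'], which lies in [<<J>>], so [q^-1] is in [<<J>>]. By the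
   choice of [J], [y'^-1] makes all positive roots in the span of [J] negative. *)
pose J := [set k in S | [exists m in descR C y', y' ** a m == - a k]].
have JS : J \subset S by apply/subsetP => i; rewrite inE => /andP[].
have hV r : r \in M -> pos (-1 *: (h^-1%g ** a r)).
  move=> rM; have rS := subsetP MS r rM; rewrite scaleN1r.
  case: (pos_or_neg (root_simple h^-1%g rS)) => // pr.
  have := neg_act MS hneg pr; rewrite inspan_act ?groupV // inspan_simple //.
  by rewrite actVK => /(_ isT)/(pos_neg (simple_pos rS)).
(* [c2] maps [a m] to the simple root of a descent of [u'], which [lift] pulls back to [a i]; hence
   [y' ** a m = h ** a i]. As [h] is negative on [M], [simple_preim] with scalar [-1] makes this
   minus a simple root. *)
have desc' m : m \in descR C y' -> exists2 k, k \in J & y' ** a m = - a k.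
  move=> my; have [e eu E] := loc_desc MS xM hM y'M c2M Ey' ut'1 uG' my.
  have [i iS Ei] := lift e eu; have iM := IM i e eu iS Ei.
  have Em : y' ** a m = h ** a i.
    rewrite /y' actM; congr (_ ** _); apply: (@act_inj c).
    by rewrite Ei Ec actM actVK.
  have [|||r rM Er] := @simple_preim M h^-1%g (-1) (- (h ** a i)) i MS hV _ _ iS.
  - exact: hneg.
  - by rewrite inspanN inspan_act // inspan_simple.
  - by rewrite actN actK scaleN1r opprK.
  have Ey2 : y' ** a m = - a r by rewrite Em -Er opprK.
  exists r => //; rewrite inE (subsetP MS) //=; apply/exists_inP.
  by exists m => //; apply/eqP.
have yG' : shardG C y' \subset <<J>>.
  apply/(@shardG_sub y' <<J>>%G) => m my; have [r rJ E] := desc' m my.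
  have mS := subsetP (descR_sub y') m my; have rS := subsetP JS r rJ.
  have /(conj_simple mS rS) : (y' * m)%g ** a m = a r.
    by rewrite actM act_simple_self // actN E opprK.
  rewrite invMg mulgA mulgK => ->; exact: mem_gen.
have yJ : q^-1%g \in <<J>>.
  apply: (shardG_parab JS); apply: subset_trans yG'.
  rewrite -(conjSg _ _ x^-1%g).
  rewrite -(loc_shardG MS xM hM yM pM Ey ut uGM).
  by rewrite -(loc_shardG MS xM hM y'M c2M Ey' ut'1 uG').
apply/le_invP => b pb nb; apply: (neg_act JS _ pb (inspan_inv JS yJ pb nb)) => r.
rewrite inE => /andP[rS /exists_inP[m my /eqP E]].
have -> : a r = - (y' ** a m) by rewrite E opprK.
by rewrite actN actK opprK simple_pos // (subsetP (descR_sub y')).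
Qed.

Lemma parab_longest J : J \subset S ->
  exists2 h, h \in <<J>> & {in J, forall s, pos (- (h ** a s))}.
Proof.
move=> JS; pose P z := z \in <<J>>.
have P1 : P 1%g by exact: group1.
case: (@arg_maxnP W 1%g P (fun z => nl z) P1) => h hJ hmax; exists h => // s sJ.
have sS := subsetP JS s sJ; rewrite -negP_pos ?root_simple //; apply/negP => ps.
have := hmax (h * s)%g; rewrite /= nl_mulr_simple // ltnn => H.
by have := H (groupM hJ (mem_gen sJ)).
Qed.

(** * Intervals of the shard order *)

Section Interval.

Variable w : W.

Notation D := (descR C w).
Let DS : D \subset S := descR_sub w.

Variables (x h : W).
Hypotheses (wE : w = (x * h)%g) (hD : h \in <<D>>) (xD : minrep D x).

(** This is the [y] of the localization: [u * c = x * y] means [u^-1 * x = c * y^-1] with [c]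
    minimal. *)
Let phi u := ((parab_part C (u^-1 * x) D)^-1)%g.

Let h_neg : {in D, forall s, pos (- (h ** a s))}.
Proof.
move=> s sD; have sS := subsetP DS s sD; move: (sD); rewrite mem_descR sS wE actM.
by rewrite (minrep_neg DS xD) ?root_simple // inspan_act // inspan_simple.
Qed.

Let shardG_top : shardG C w :=: (<<D>> :^ x^-1)%g.
Proof.
have -> : (<<D>> :^ x^-1 = <<D>> :^ w^-1)%g.
  have -> : (w^-1 = h^-1 * x^-1)%g by rewrite -invMg -wE.
  have hV : h^-1%g \in <<D>> by rewrite groupV.
  by rewrite conjsgM (conjGid hV).
by rewrite /= -genJ.
Qed.

Let phiD u : phi u \in <<D>>.
Proof. by rewrite /phi groupV; case: (parab_partP (u^-1 * x) DS). Qed.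

Let phi_min u : minrep D (u^-1 * x * phi u)%g.
Proof. by case: (parab_partP (u^-1 * x) DS). Qed.

Let phi_eq u : (u * (u^-1 * x * phi u) = x * phi u)%g.
Proof. by rewrite !mulgA mulgV mul1g. Qed.

Let below_inv u : shard_le Phi u w -> (N u `<=` N (x * h)%g)%fset.
Proof. by rewrite /shard_le wE => /andP[]. Qed.

Let below_shardG u : shard_le Phi u w -> shardG C u \subset (<<D>> :^ x^-1)%g.
Proof. by rewrite -shardG_top => /andP[]. Qed.

Let phi_le u : shard_le Phi u w -> (N u `<=` N (x * phi u)%g)%fset.
Proof.
by move/below_inv; apply: (loc_le DS hD (phiD u) (phi_min u) (phi_eq u)).
Qed.

Let phi_shardG u : shard_le Phi u w -> shardG C u :=: (shardG C (phi u) :^ x^-1)%g.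
Proof.
move=> uw; exact: (loc_shardG DS xD hD (phiD u) (phi_min u) (phi_eq u)
  (below_inv uw) (below_shardG uw)).
Qed.

(** The groups are conjugate by [x]. For inversions, one direction is [le_of_shardG] with
    [x * phi u'] as common bound; in the other, minimality shows that [x ** b] is an inversion of
    [u] exactly when [b] is one of [phi u], for [b] positive in the span of [D]. *)
Let phi_mono u u' : shard_le Phi u w -> shard_le Phi u' w ->
  shard_le Phi (phi u) (phi u') = shard_le Phi u u'.
Proof.
move=> uw u'w; rewrite /shard_le (phi_shardG uw) (phi_shardG u'w) conjSg.
case uG: (_ \subset _); rewrite ?andbF ?andbT //; apply/idP/idP => [le|/le_invP le].
  apply: (@le_of_shardG u u' (u'^-1 * x * phi u')%g); rewrite ?phi_eq.
  - by apply: fsubset_trans (phi_le uw) _; apply: (mul_minrep_le DS xD).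
  - exact: phi_le.
  - by rewrite (phi_shardG uw) (phi_shardG u'w) conjSg.
  exact: (loc_lift_gens DS (phiD u') (phi_min u') (phi_eq u') (below_shardG u'w)).
apply/le_invP => b pb nb; have db := inspan_inv DS (phiD u) pb nb.
have px := minrep_pos DS xD pb db.
have E z : z^-1%g ** x ** b = (z^-1 * x * phi z)%g ** (phi z)^-1%g ** b.
  by rewrite -!actM mulgK.
have r z : root ((phi z)^-1%g ** b) by exact/act_root/pos_root.
have d z : inspan D ((phi z)^-1%g ** b) by rewrite inspan_act // groupV.
have := le _ px; rewrite !E !(minrep_neg DS (phi_min _)) //; exact.
Qed.

Let phi_surj y : y \in <<D>> -> exists2 u, shard_le Phi u w & phi u = y.
Proof.
move=> yD; have [u [uN uG um]] := loc_surj DS xD yD; exists u.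
  rewrite /shard_le shardG_top uG andbT wE; apply: (fsubset_trans uN).
  by apply: (mul_minrep_le DS xD) => //; apply: neg_le h_neg.
apply: invg_inj; rewrite invgK.
have -> : (u^-1 * x = u^-1 * (x * y) * y^-1)%g by rewrite !mulgA mulgK.
by apply: parab_partE => //; rewrite groupV.
Qed.

Lemma nchain_shard_interval k :
  nchain (shard_le Phi) k.+1 w
    = (\sum_(y in <<D>>) nchain (shard_le Phi) k y)%N.
Proof.
have tr u y z : shard_le Phi u y -> shard_le Phi y z -> shard_le Phi u z.
  move=> /andP[n1 g1] /andP[n2 g2]; apply/andP; split.
    exact: fsubset_trans n1 n2.
  exact: subset_trans g1 g2.
have phiI : {in [pred u | shard_le Phi u w] &, injective phi}.
  move=> u u'; rewrite !inE => uw u'w E.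
  have rf z : shard_le Phi z z by rewrite /shard_le fsubset_refl subxx.
  have /andP[l1 _] : shard_le Phi u u' by rewrite -phi_mono // E.
  have /andP[l2 _] : shard_le Phi u' u by rewrite -phi_mono // E.
  exact: le_inv_anti.
have E u : shard_le Phi u w ->
    nchain (shard_le Phi) k u = nchain (shard_le Phi) k (phi u).
  (* That [<<D>>] is down-closed comes from the groups alone, through [shardG_parab]. *)
  apply: (@nchain_iso _ _ k phi [pred u | shard_le Phi u w] [pred y | y \in <<D>>]) => //.
  - by move=> u1 u2 /= u12 u2w; apply: tr u12 u2w.
  - move=> y1 y2 /= /andP[_ yG] y2D; apply: (shardG_parab DS).
    exact: subset_trans yG (shardG_desc DS y2D).
  by move=> u1 _; apply: phiD.
rewrite /= (eq_bigr _ E) -big_set -(big_imset (nchain (shard_le Phi) k)) /=.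
  apply: eq_bigl => y; apply/imsetP/idP => [[u _ ->] //|yD].
  by have [u uw <-] := phi_surj yD; exists u; rewrite ?inE.
by move=> u u'; rewrite !inE; apply: phiI.
Qed.

End Interval.

Lemma nchain_shard k w :
  nchain (shard_le Phi) k.+1 w
    = (\sum_(y in <<descR C w>>) nchain (shard_le Phi) k y)%N.
Proof.
have [x [h [wE hD xD]]] := parab_decomp w (descR_sub w).
exact: (nchain_shard_interval wE hD xD).
Qed.

(** * The BHZ order *)

Lemma bhz_leE u w : bhz_le C u w = minrep (supp C u) (w * u^-1)%g.
Proof.
have uI : u \in <<supp C u>> by rewrite -supp_sub ?supp_gens.
apply/eqP/idP => [E|um].
  by have [_] := parab_partP w (supp_gens u); rewrite E.
by rewrite -{1}[w](mulgKV u) parab_partE ?supp_gens.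
Qed.

(** By minimality of [x], a descent of [u] is one of [x * u], hence in [J]; it can be stripped from
    both. *)
Lemma minrep_mul_parab I J x u : I \subset S -> J \subset S -> u \in <<I>> ->
  minrep I x -> (x * u)%g \in <<J>> -> u \in <<J>>.
Proof.
move=> IS JS; have [k] := ubnP (nl u); elim: k => // k IH in u *; rewrite ltnS.
move=> uk uI xI xuJ; case: (eqVneq u 1%g) => [->|]; first exact: group1.
case/exists_neg_simple => s sS ns.
have su : s \in descR C u by rewrite mem_descR sS.
have sI := subsetP (descR_parab IS uI) s su.
have sJ : s \in J.
  apply: (subsetP (descR_parab JS xuJ)); rewrite mem_descR sS actM.
  by rewrite (minrep_neg IS xI) ?root_simple // inspan_act // inspan_simple.
rewrite -[u]mulg1 -(gens_invol sS) mulgA groupM ?(mem_gen sJ) //.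
apply: IH => //; first exact: leq_trans (nl_descR su) uk.
  by rewrite groupM // mem_gen.
by rewrite mulgA groupM // mem_gen.
Qed.

Lemma sum_nchain_bhz J k : J \subset S ->
  (\sum_(w in <<J>>) nchain (bhz_le C) k.+1 w
    = \sum_(x in <<J>>) \sum_(u in <<descR C x>>) nchain (bhz_le C) k u)%N.
Proof.
move=> JS; set q := nchain (bhz_le C) k.
have [h hJ hneg] := parab_longest JS.
(* The longest element [h] reverses the sign of every root in the span of [J]. *)
have desch x : x \in <<J>> -> descR C (h * x)%g = J :\: descR C x.
  move=> xJ; have hxJ : (h * x)%g \in <<J>> by rewrite groupM.
  apply/setP => s; rewrite in_setD; apply/idP/andP => [sh|[]].
    have sJ := subsetP (descR_parab JS hxJ) s sh; have sS := subsetP JS s sJ.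
    split=> //; apply/negP; rewrite mem_descR => /andP[_ nx].
    have := neg_act JS hneg nx; rewrite inspanN inspan_act // inspan_simple //.
    move: sh; rewrite mem_descR sS actM actN opprK => nh /(_ isT) ph.
    exact: (pos_neg ph nh).
  move=> sx sJ; have sS := subsetP JS s sJ.
  move: sx; rewrite !mem_descR sS /= -negP_pos ?root_simple // negbK => px.
  by rewrite actM; apply: (neg_act JS hneg px); rewrite inspan_act // inspan_simple.
transitivity (\sum_(x in <<J>>) \sum_(u in <<J :\: descR C x>>) q u)%N; last first.
  rewrite [RHS](reindex_inj (mulgI h)) /=; apply: eq_big => [x|x xJ].
    by rewrite groupMl.
  by rewrite desch.
rewrite /= (exchange_big_dep (fun u => u \in <<J>>)) /= => [|w u wJ]; last first.
  rewrite bhz_leE => um.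
  apply: (@minrep_mul_parab (supp C u) J (w * u^-1)%g) => //.
  - exact: supp_gens.
  - by rewrite -supp_sub ?supp_gens.
  by rewrite mulgKV.
rewrite [RHS](exchange_big_dep (fun u => u \in <<J>>)) /= => [|x u _]; last first.
  by apply/subsetP/genS/subsetDl.
(* With [w = x * u], the relation says that [supp C u] avoids [descR C x], so that [u] lies in
   [<<J :\: descR C x>>]. *)
apply: eq_bigr => u uJ; rewrite (reindex_inj (mulIg u)) /=.
apply: eq_bigl => x; rewrite groupMr // bhz_leE mulgK minrep_descR ?supp_gens //.
case xJ: (x \in _) => //=; rewrite -supp_sub; last first.
  exact: subset_trans (subsetDl _ _) JS.
by rewrite subsetD supp_sub // uJ disjoint_sym.
Qed.

(** * Comparison of the two counts *)

Lemma sum_nchain_eq J k : J \subset S ->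
  (\sum_(w in <<J>>) nchain (shard_le Phi) k w
    = \sum_(w in <<J>>) nchain (bhz_le C) k w)%N.
Proof.
elim: k J => [|k IH] J JS; first by [].
rewrite sum_nchain_bhz //; apply: eq_bigr => w _; rewrite nchain_shard.
exact/IH/descR_sub.
Qed.

Lemma sum_supp J (F : W -> nat) : J \subset S ->
  (\sum_(w in <<J>>) F w
    = \sum_(I in powerset J) \sum_(w | supp C w == I) F w)%N.
Proof.
move=> JS; rewrite (partition_big (supp C) (fun I => I \in powerset J)) /=.
  apply: eq_bigr => I; rewrite powersetE => IJ; apply: eq_bigl => w.
  by case: eqP => [E|]; rewrite ?andbF // andbT -supp_sub // E.
by move=> w wJ; rewrite powersetE supp_sub.
Qed.

(** Induction on the size of [J]: the sums over [<<J>>] agree, and so do the contributions of the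
    proper subsets of [J]. *)
Lemma sum_supp_eq J k : J \subset S ->
  (\sum_(w | supp C w == J) nchain (shard_le Phi) k w
    = \sum_(w | supp C w == J) nchain (bhz_le C) k w)%N.
Proof.
have [m] := ubnP #|J|; elim: m => // m IH in J *; rewrite ltnS => Jm JS.
have := sum_nchain_eq k JS; rewrite !sum_supp //.
rewrite (bigD1 J) ?powersetE //= [X in _ = X -> _](bigD1 J) ?powersetE //=.
rewrite [X in (_ + X)%N = _](eq_bigr (fun I =>
  \sum_(w | supp C w == I) nchain (bhz_le C) k w)%N) => [/addIn //|I].
case/andP; rewrite powersetE => IJ nIJ; apply: IH; last exact: subset_trans IJ JS.
by rewrite (leq_trans _ Jm) // proper_card // properEneq nIJ.
Qed.

End RootSystemTheory.

Theorem theorem1p1 (W : finGroupType) (C : coxeterSystem W)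
    (R : realType) (n : nat) (Phi : rootSystem R n C)
    (J : {set W}) (hJ : J \subset gens C) (k : nat) (hk : 0 < k) :
  #|chains C (shard_le Phi) k J| = #|chains C (bhz_le C) k J|.
Proof.
(* Below the top of a chain of length [k.+1] there are [k] elements, hence the index [k] of
   [nchain]. *)
case: k hk => // k _; rewrite /chains.
rewrite (card_chains _ k (fun v => supp C v == J)).
rewrite (card_chains _ k (fun v => supp C v == J)).
exact: sum_supp_eq.
Qed.
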